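(* Let $n\in\mathbb{N}_+$ and let $\lambda,\mu^0,\mu^1,\dots,\mu^{n-1}$ be partitions. If the Littlewood–Richardson coefficient $c^\lambda_{\mu^0,\mu^1,\dots,\mu^{n-1}}$ is nonzero, then \[[\lambda]\subseteq\Big\langle \sum_{k=0}^{n-1}\mathrm{OC}(\mu^k)\Big\rangle^c,\] where $\sum_k \mathrm{OC}(\mu^k)=\{p_0+p_1+\dots+p_{n-1}: p_k\in\mathrm{OC}(\mu^k)\}$ is the Minkowski sum with coordinatewise addition in $\mathbb{N}_0^2$. Equivalently, no point of $\sum_k\mathrm{OC}(\mu^k)$ lies in $[\lambda]$.
   Context: For a partition $\lambda=(\lambda_1\ge\lambda_2\ge\cdots)$, its diagram is $[\lambda]=\{(j,i)\in\mathbb{N}_0^2: 0\le j<\lambda_{i+1}\}$, where the first coordinate is the column index and the second the row index, both starting at $0$. The set of outer corners $\mathrm{OC}(\mu)$ of a partition $\mu$ is the set of points $(c,r)\in\mathbb{N}_0^2\setminus[\mu]$ such that ($c=0$ or $(c-1,r)\in[\mu]$) and ($r=0$ or $(c,r-1)\in[\mu]$); these are the minimal elements of $\mathbb{N}_0^2\setminus[\mu]$ for the componentwise order. For example, $\mathrm{OC}((3,2))=\{(0,2),(2,1),(3,0)\}$. For $S\subseteq\mathbb{N}_0^2$, let $\langle S\rangle=\{p\in\mathbb{N}_0^2: p\ge s \text{ componentwise for some } s\in S\}$, and let $\langle S\rangle^c=\mathbb{N}_0^2\setminus\langle S\rangle$. The coefficient $c^\lambda_{\mu^0,\dots,\mu^{n-1}}$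 is the coefficient of $s_\lambda$ in the Schur expansion of the product $s_{\mu^0}s_{\mu^1}\cdots s_{\mu^{n-1}}$. *)

(* Defs.v *)
From HB Require Import structures.
From mathcomp Require Import all_boot all_order all_algebra.
From mathcomp Require Import mpoly.
Set Implicit Arguments. Unset Strict Implicit. Unset Printing Implicit Defensive.
Import GRing.Theory.

Definition is_part (l : seq nat) : bool := sorted geq l && all (fun x => 0 < x) l.

(* (c, r) \in [l]  :  column c, row r (0-based), i.e. c < l_{r+1}. *)
Definition indiag (l : seq nat) (c r : nat) : bool := c < nth 0 l r.

Definition isOC (mu : seq nat) (p : nat * nat) : bool :=
  [&& ~~ indiag mu p.1 p.2,
      (p.1 == 0) || indiag mu p.1.-1 p.2
    & (p.2 == 0) || indiag mu p.1 p.2.-1].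

(* Semistandard Young tableaux of shape l with entries in 'I_N, encoded as
   finite functions on the bounding box 'I_(size l) * 'I_(l_1); cells outside
   the diagram carry the value 0 (so that each SSYT is counted once). *)
Definition ssytb (N : nat) (l : seq nat)
    (T : {ffun 'I_(size l) * 'I_(nth 0 l 0) -> 'I_N}) : bool :=
  [&& [forall c : 'I_(size l) * 'I_(nth 0 l 0),
         indiag l c.2 c.1 || (nat_of_ord (T c) == 0)],
      [forall i : 'I_(size l), forall j : 'I_(nth 0 l 0), forall j' : 'I_(nth 0 l 0),
         ((j < j') && indiag l j' i) ==> (T (i, j) <= T (i, j'))]
    & [forall i : 'I_(size l), forall i' : 'I_(size l), forall j : 'I_(nth 0 l 0),
         ((i < i') && indiag l j i') ==> (T (i, j) < T (i', j))]].

Definition schur (N : nat) (l : seq nat) : {mpoly int[N]} :=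
  \sum_(T : {ffun 'I_(size l) * 'I_(nth 0 l 0) -> 'I_N} | ssytb T)
     \prod_(c : 'I_(size l) * 'I_(nth 0 l 0) | indiag l c.2 c.1) 'X_(T c).

(* Main.v *)
(** Let H(b,a) be the span of the Schur functions s_lam whose diagram avoids the
    cell (a,b), i.e. lam_(b+1) <= a.  By Pieri's rule, multiplication by complete
    symmetric functions maps H(b,a) into H(b+1,a), and conversely H(b+1,a) is spanned
    by such products: s_lam is obtained from h_(lam_1) s_(lam_2, lam_3, ...) by
    subtracting Schur functions with a longer first row.  Hence
    H(b,a) H(b',a') is contained in H(b+b',a+a') as soon as this holds for b = b' = 0,
    where it follows by comparing degrees in the first variable.  The theorem is the
    case of several factors, as mu^k avoids each of its outer corners.  *)

Require Import Defs.
From HB Require Import structures.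
From mathcomp Require Import all_boot all_order all_algebra.
From mathcomp Require Import mpoly.
From mathcomp Require Import zify.
Set Implicit Arguments. Unset Strict Implicit. Unset Printing Implicit Defensive.
Import GRing.Theory.

(** * Horizontal strips and the Pieri rule *)

(** All computations take place in N variables, where a Schur polynomial with more than N rows
    vanishes. Shapes are lists of one fixed length L >= N, so Pieri's rule loses nothing when a
    strip would add a row beyond L. Comparing degrees presupposes that a product of Schur
    polynomials is again an integral combination of Schur polynomials. This is obtained from the
    same reduction to b = b' = 0, run with a = a' = 0: there the space consists of the integers, so
    the base case is trivial, while for b >= L the condition on shapes is vacuous. Degrees are then
    compared after X_i |-> X^(B^(N-1-i)). For large B the nonzero images of Schur polynomials are
    monic of pairwise distinct degrees, so the top term of a combination cannot cancel, and the
    leading base-B digit of the degree is the first row. *)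

Fixpoint box (L M : nat) : seq (seq nat) :=
  if L is L'.+1 then [seq a :: l | a <- iota 0 M.+1, l <- box L' M] else [:: [::]].

Lemma mem_box L M l :
  (l \in box L M) = (size l == L) && all (fun a => a <= M) l.
Proof.
elim: L l => [|L IH] [|a l] //; first by apply/allpairsP => -[[b m] [_ _]].
apply/allpairsP/idP => [[[b m] [hb hm e]]|].
  move: hb hm; rewrite mem_iota IH; case: e => -> -> /= hb /andP[sm hm].
  by rewrite eqSS sm hm -ltnS hb.
move=> /andP[sl /= /andP[ha hl]]; exists (a, l).
split => /=.
- by rewrite -[0 :: _]/(iota 0 M.+1) mem_iota ltnS.
- by rewrite IH -eqSS sl.
- by [].
Qed.

Lemma uniq_box L M : uniq (box L M).
Proof.
elim: L => // L IH; apply: allpairs_uniq => //; first exact: iota_uniq.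
by move=> [a l] [b m] _ _ [-> ->].
Qed.

Arguments box : simpl never.

Lemma box_nthP L M l :
  reflect (size l = L /\ forall i, nth 0 l i <= M) (l \in box L M).
Proof.
rewrite mem_box; apply: (iffP andP) => [[/eqP <- /all_nthP h]|[<- h]]; split => //.
  move=> i; have [il|il] := ltnP i (size l); first exact: h.
  by rewrite nth_default.
by apply/(all_nthP 0) => i _.
Qed.

Lemma sumn_nth L l : size l = L -> sumn l = \sum_(i < L) nth 0 l i.
Proof. by move=> <-; rewrite sumnE (big_nth 0) big_mkord. Qed.

(* The skew shape l/m is a horizontal strip. *)
Definition hstrip (l m : seq nat) : bool :=
  (size m == size l) &&
  all (fun i => nth 0 l i.+1 <= nth 0 m i <= nth 0 l i) (iota 0 (size l)).

Lemma hstripP l m :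
  reflect (size m = size l /\ forall i, nth 0 l i.+1 <= nth 0 m i <= nth 0 l i)
          (hstrip l m).
Proof.
apply: (iffP andP) => [[/eqP sm /allP h]|[sm h]]; split => //.
- move=> i; have [il|il] := ltnP i (size l); first by apply: h; rewrite mem_iota.
  by rewrite !nth_default // ?sm // ltnW.
- exact/eqP.
- by apply/allP => i _.
Qed.

Definition dec (l : seq nat) := forall i, nth 0 l i.+1 <= nth 0 l i.

Lemma dec_le l i j : dec l -> i <= j -> nth 0 l j <= nth 0 l i.
Proof.
move=> h; elim: j => [|j IH]; first by rewrite leqn0 => /eqP ->.
by rewrite leq_eqVlt => /orP[/eqP -> //|/IH]; apply: leq_trans.
Qed.

Lemma hstrip_dec1 l m : hstrip l m -> dec l.
Proof. by move=> /hstripP[_ h] i; have /andP[] := h i; apply: leq_trans. Qed.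

Lemma hstrip_dec2 l m : hstrip l m -> dec m.
Proof.
move=> /hstripP[_ h] i; have /andP[h1 _] := h i; have /andP[_ h2] := h i.+1.
exact: leq_trans h2 h1.
Qed.

Lemma hstrip_size l m : hstrip l m -> size m = size l.
Proof. by case/hstripP. Qed.

Lemma hstrip_sumn l m : hstrip l m -> sumn m <= sumn l.
Proof.
case/hstripP => sm h; rewrite (sumn_nth sm) (sumn_nth (erefl (size l))).
by apply: leq_sum => i _; case/andP: (h i).
Qed.

Lemma le_sumn_eq l m : size m = size l -> (forall i, nth 0 m i <= nth 0 l i) ->
  sumn l = sumn m -> l = m.
Proof.
move=> sm h; rewrite (sumn_nth sm) (sumn_nth (erefl (size l))) => e.
have ei (i : 'I_(size l)) : nth 0 l i = nth 0 m i.
  have := leqif_sum (I := 'I_(size l)) (P := xpredT)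
    (C := fun i : 'I_(size l) => nth 0 m i == nth 0 l i)
    (E1 := fun i : 'I_(size l) => nth 0 m i)
    (E2 := fun i : 'I_(size l) => nth 0 l i).
  case=> [j _|_]; first by split.
  by rewrite e eqxx => /esym/forallP/(_ i)/eqP.
by apply: (@eq_from_nth _ 0) => // i il; apply: (ei (Ordinal il)).
Qed.

Lemma big_seq_sub (R : nmodType) (T : eqType) (s1 s2 : seq T) (P : pred T)
    (F : T -> R) :
  uniq s1 -> uniq s2 -> (forall a, P a -> (a \in s1) = (a \in s2)) ->
  (\sum_(a <- s1 | P a) F a = \sum_(a <- s2 | P a) F a)%R.
Proof.
move=> u1 u2 h; rewrite -[LHS]big_filter -[RHS]big_filter.
apply/perm_big/uniq_perm; rewrite ?filter_uniq // => a.
by rewrite !mem_filter; case hP: (P a) => //=; apply: h.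
Qed.

Lemma count_bij (T1 T2 : eqType) (s1 : seq T1) (s2 : seq T2)
    (P1 : pred T1) (P2 : pred T2) (f : T1 -> T2) (g : T2 -> T1) :
  uniq s1 -> uniq s2 ->
  (forall a, a \in s1 -> P1 a -> [/\ f a \in s2, P2 (f a) & g (f a) = a]) ->
  (forall b, b \in s2 -> P2 b -> [/\ g b \in s1, P1 (g b) & f (g b) = b]) ->
  count P1 s1 = count P2 s2.
Proof.
move=> u1 u2 hf hg; rewrite -!size_filter.
have hm : map f (filter P1 s1) =i filter P2 s2.
  move=> b; apply/mapP/idP => [[a]|].
    by rewrite !mem_filter => /andP[p1 s1a] ->; case: (hf a s1a p1) => -> ->.
  rewrite mem_filter => /andP[p2 s2b]; have [h1 h2 h3] := hg b s2b p2.
  by exists (g b); rewrite ?mem_filter ?h1 ?h2.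
have um : uniq (map f (filter P1 s1)).
  rewrite map_inj_in_uniq ?filter_uniq // => a a'.
  rewrite !mem_filter => /andP[p sa] /andP[p' sa'] e.
  by case: (hf a sa p) (hf a' sa' p') => _ _ <- [_ _ <-]; rewrite e.
by rewrite -(size_map f); apply/perm_size/uniq_perm; rewrite ?filter_uniq.
Qed.

Section GT.
Variables (R : comNzRingType) (x : nat -> R).
Local Open Scope ring_scope.

(* Gelfand-Tsetlin recursion for the Schur polynomial in x_0, ..., x_(k-1);
   partitions are lists of a fixed length, padded with zeros. *)
Fixpoint gs (k : nat) (l : seq nat) : R :=
  if k is k'.+1 then
    \sum_(m <- box (size l) (nth 0%N l 0) | hstrip l m)
       x k' ^+ (sumn l - sumn m) * gs k' m
  else (all (eq_op 0%N) l)%:R.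

(** The strip condition already bounds every entry of [m] by the first entry of [l], so any larger
    box gives the same sum. Sums over several shapes can thus share one box, which the interchanges
    of summation in [pieri] require. *)
Lemma gsS M k l : (nth 0 l 0 <= M)%N ->
  gs k.+1 l = \sum_(m <- box (size l) M | hstrip l m)
       x k ^+ (sumn l - sumn m) * gs k m.
Proof.
move=> lM /=; apply: big_seq_sub; rewrite ?uniq_box // => m hm.
have dm := hstrip_dec2 hm; case/hstripP: hm => sm h.
have m0 : (nth 0 m 0 <= nth 0 l 0)%N by case/andP: (h 0%N).
have mi i : (nth 0 m i <= nth 0 l 0)%N.
  exact: leq_trans (dec_le dm (leq0n i)) m0.
apply/box_nthP/box_nthP => _; split => // i.
exact: leq_trans (mi i) lM.
Qed.

(** Interlacing gives [m_i >= l_(i+1)]: a positive entry moves up by at most one row for each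
    variable removed, and with no variable left it makes the value 0. *)
Lemma gs_vanish k l i : (k <= i)%N -> (0 < nth 0 l i)%N -> gs k l = 0.
Proof.
elim: k l i => [|k IH] l i ki hl /=.
  case: (boolP (all _ _)) => // /all_nthP h; move: hl.
  have [il|il] := ltnP i (size l); last by rewrite nth_default.
  by rewrite -(eqP (h 0%N i il)).
rewrite big1 // => m /hstripP[_ h]; case: i ki hl => // i ki hl.
rewrite (IH _ i) ?mulr0 //.
by case/andP: (h i) => h1 _; apply: leq_trans h1.
Qed.

(** The complete homogeneous symmetric polynomial of degree [m] in [k] variables, split by the
    exponent of the last one. *)
Fixpoint hsym (k m : nat) : R :=
  if k is k'.+1 then \sum_(j < m.+1) x k' ^+ j * hsym k' (m - j)
  else (m == 0%N)%:R.

End GT.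

Lemma sum_maxmin (L : nat) (f g : nat -> nat) :
  \sum_(i < L) maxn (f i) (g i) + \sum_(i < L) minn (f i) (g i) =
  \sum_(i < L) f i + \sum_(i < L) g i.
Proof. by rewrite -!big_split; apply: eq_bigr => i _ /=; lia. Qed.

(* The entries lam_(i+1) and kap_i range over the same interval
   [max(mu_(i+1), nu_(i+1)), min(mu_i, nu_i)]; reflecting that interval exchanges
   the two families, and lam_0 is determined by the size of lam. *)
Lemma count_strips L M m mu nu : size mu = L.+1 -> size nu = L.+1 ->
  dec mu -> nth 0 nu L = 0 -> nth 0 mu 0 + m <= M ->
  count (fun lam => [&& hstrip lam mu, sumn lam == sumn mu + m & hstrip lam nu])
    (box L.+1 M) =
  count (fun kap => [&& hstrip mu kap, hstrip nu kap & sumn nu <= sumn kap + m])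
    (box L.+1 M).
Proof.
move=> smu snu dmu nuL hM.
pose mx i := maxn (nth 0 mu i) (nth 0 nu i).
pose mn i := minn (nth 0 mu i) (nth 0 nu i).
pose f lam := mkseq (fun i => mx i.+1 + mn i - nth 0 lam i.+1) L.+1.
pose g kap := mkseq (fun i => if i is i'.+1 then mx i + mn i' - nth 0 kap i'
                       else mx 0 + m + sumn kap - sumn nu) L.+1.
(* Since [nu_L = 0], the interval with index [L] is reduced to 0, so the reflection stays within
   lists of length [L.+1]. *)
have nuS i : L <= i -> nth 0 nu i = 0.
  by rewrite leq_eqVlt => /orP[/eqP <- //|h]; rewrite nth_default // snu.
have muS i : L < i -> nth 0 mu i = 0 by move=> h; rewrite nth_default // smu.
have nf lam i : size lam = L.+1 -> nth 0 (f lam) i = mx i.+1 + mn i - nth 0 lam i.+1.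
  move=> sl; have [h|h] := ltnP i L.+1; first by rewrite nth_mkseq.
  rewrite nth_default ?size_mkseq // /mx /mn; move: (muS i.+1) (nuS i.+1) (nuS i); lia.
have ng0 kap : nth 0 (g kap) 0 = mx 0 + m + sumn kap - sumn nu by rewrite nth_mkseq.
have ng kap i : size kap = L.+1 -> nth 0 (g kap) i.+1 = mx i.+1 + mn i - nth 0 kap i.
  move=> sl; have [h|h] := ltnP i.+1 L.+1; first by rewrite nth_mkseq.
  rewrite nth_default ?size_mkseq // /mx /mn; move: (muS i.+1) (nuS i.+1) (nuS i); lia.
(* Summing the reflection, with max + min = sum, turns [sumn lam = sumn mu + m] into
   [lam_0 = mx 0 + m + sumn kap - sumn nu]. The only strip constraint on [lam_0] is [mx 0 <= lam_0],
   which becomes [sumn nu <= sumn kap + m]. *)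
have total lam kap : size lam = L.+1 -> size kap = L.+1 ->
    (forall i, nth 0 kap i + nth 0 lam i.+1 = mx i.+1 + mn i) ->
    sumn lam + mx 0 + sumn kap = nth 0 lam 0 + sumn mu + sumn nu.
  move=> sl sk e.
  have E : \sum_(i < L.+1) (nth 0 kap i + nth 0 lam i.+1) =
           \sum_(i < L.+1) (mx i.+1 + mn i) by apply: eq_bigr.
  have s1 (F : nat -> nat) : F L.+1 = 0 -> \sum_(i < L.+1) F i.+1 + F 0 = \sum_(i < L.+1) F i.
    move=> F0; transitivity (\sum_(i < L.+2) F i); first by rewrite addnC [RHS]big_ord_recl.
    by rewrite big_ord_recr /= F0 addn0.
  have l1 := s1 (nth 0 lam) (nth_default 0 (eq_leq sl)).
  have x1 := s1 mx; rewrite {1}/mx muS // nuS // in x1; have {}x1 := x1 erefl.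
  have mm := sum_maxmin L.+1 (nth 0 mu) (nth 0 nu).
  rewrite !big_split /= in E.
  rewrite (sumn_nth sl) (sumn_nth sk) (sumn_nth smu) (sumn_nth snu).
  have := mm; rewrite -/(mx _) -/(mn _) => {}mm.
  change (\sum_(i < L.+1) mx i + \sum_(i < L.+1) mn i =
    \sum_(i < L.+1) nth 0 mu i + \sum_(i < L.+1) nth 0 nu i) in mm.
  move: l1 x1 E mm; clear.
  move: (\sum_(i < L.+1) nth 0 lam i.+1) (\sum_(i < L.+1) nth 0 lam i)
    (\sum_(i < L.+1) mx i.+1) (\sum_(i < L.+1) mx i) (\sum_(i < L.+1) mn i)
    (\sum_(i < L.+1) nth 0 kap i) (\sum_(i < L.+1) nth 0 mu i)
    (\sum_(i < L.+1) nth 0 nu i) (mx 0) (nth 0 lam 0); lia.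
apply: (count_bij (f := f) (g := g)); rewrite ?uniq_box //.
- move=> lam /box_nthP[sl lM] /and3P[/hstripP[_ h1] /eqP h2 /hstripP[_ h3]].
  have sf : size (f lam) = L.+1 by rewrite size_mkseq.
  have e i : nth 0 (f lam) i + nth 0 lam i.+1 = mx i.+1 + mn i.
    rewrite nf // /mx /mn; move: (h1 i) (h3 i) (h1 i.+1) (h3 i.+1); lia.
  have t := total _ _ sl sf e.
  have hl0 : mx 0 <= nth 0 lam 0 by rewrite /mx; move: (h1 0) (h3 0); lia.
  split.
  + apply/box_nthP; split => // i; move: (e i) (h1 i) (h3 i) (dec_le dmu (leq0n i)).
    move: (h1 i.+1) (h3 i.+1); rewrite /mx /mn; lia.
  + apply/and3P; split.
    * apply/hstripP; split => [|i]; first by rewrite sf smu.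
      move: (e i) (h1 i) (h3 i) (h1 i.+1) (h3 i.+1); rewrite /mx /mn; lia.
    * apply/hstripP; split => [|i]; first by rewrite sf snu.
      move: (e i) (h1 i) (h3 i) (h1 i.+1) (h3 i.+1); rewrite /mx /mn; lia.
    * by lia.
  + apply: (@eq_from_nth _ 0) => [|i]; first by rewrite size_mkseq.
    case: i => [|i] _; first by rewrite ng0; lia.
    by rewrite ng //; move: (e i); lia.
- move=> kap /box_nthP[sl lM] /and3P[/hstripP[_ h1] /hstripP[_ h3] h2].
  have sg : size (g kap) = L.+1 by rewrite size_mkseq.
  have e i : nth 0 kap i + nth 0 (g kap) i.+1 = mx i.+1 + mn i.
    rewrite ng // /mx /mn; move: (h1 i) (h3 i) ; lia.
  have t := total _ _ sg sl e.
  have hk : sumn kap <= sumn nu by apply: hstrip_sumn; apply/hstripP; rewrite snu.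
  have g0 := ng0 kap.
  have hg1 : hstrip (g kap) mu.
    apply/hstripP; split => [|i]; first by rewrite sg smu.
    move: (e i) (h1 i) (h3 i); case: i => [|i]; rewrite /mx /mn.
      by rewrite ng0 /mx; lia.
    move: (e i) (h1 i) (h3 i); rewrite /mx /mn; lia.
  have hg2 : hstrip (g kap) nu.
    apply/hstripP; split => [|i]; first by rewrite sg snu.
    move: (e i) (h1 i) (h3 i); case: i => [|i]; rewrite /mx /mn.
      by rewrite ng0 /mx; lia.
    move: (e i) (h1 i) (h3 i); rewrite /mx /mn; lia.
  have hs : sumn (g kap) = sumn mu + m by rewrite /mx in g0 t *; lia.
  have hg0 : nth 0 (g kap) 0 <= M.
    suff : nth 0 (g kap) 0 <= nth 0 mu 0 + m by lia.
    move: hs; rewrite (sumn_nth sg) (sumn_nth smu) !big_ord_recl /=.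
    have : \sum_(i < L) nth 0 mu (bump 0 i) <= \sum_(i < L) nth 0 (g kap) (bump 0 i).
      apply: leq_sum => i _; case/hstripP: hg1 => _ hh; by case/andP: (hh (bump 0 i)).
    by move: (\sum_(i < L) _) (\sum_(i < L) _) => u v; lia.
  split.
  + apply/box_nthP; split => // i.
    exact: leq_trans (dec_le (hstrip_dec1 hg1) (leq0n i)) hg0.
  + by rewrite hg1 hg2 hs eqxx.
  + apply: (@eq_from_nth _ 0) => [|i]; first by rewrite size_mkseq.
    by rewrite size_mkseq nf // => _; move: (e i); lia.
Qed.

Section Pieri.
Variables (R : comNzRingType) (x : nat -> R).
Local Open Scope ring_scope.

Lemma sum_const_count (T : Type) (s : seq T) (P : pred T) (c : R) :
  \sum_(a <- s | P a) c = c *+ count P s.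
Proof. by rewrite big_const_seq iter_addr addr0. Qed.

Lemma hstrip_sumn_eq l m : hstrip l m -> sumn l = sumn m -> l = m.
Proof.
case/hstripP => sm h e; apply: le_sumn_eq => // i; by case/andP: (h i).
Qed.

Lemma hstrip_refl l : dec l -> hstrip l l.
Proof. by move=> d; apply/hstripP; split => // i; rewrite d leqnn. Qed.

(** Induction on the number of variables. Expanding both sides in the last variable, the coefficient
    of [gs x k nu] counts shapes [kap] below [mu] and [nu] on the left and shapes [lam] above both
    on the right; [count_strips] equates them. It asks for a zero last row of [nu], and by the bound
    on the number of variables the other [nu] contribute 0. *)
Lemma pieri k L M m mu : (k <= L)%N -> size mu = L -> dec mu ->
  (nth 0 mu 0 + m <= M)%N ->
  hsym x k m * gs x k mu =
  \sum_(lam <- box L M | hstrip lam mu && (sumn lam == sumn mu + m)%N) gs x k lam.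
Proof.
elim: k m mu => [|k IH] m mu kL smu dmu hM.
  rewrite /=.
  have [->|m0] := eqVneq m 0%N; last first.
    rewrite mul0r big1 // => lam /andP[hl /eqP e].
    case: (boolP (all _ _)) => // /allP h.
    suff : sumn lam = 0%N by lia.
    by rewrite sumnE big_seq big1 // => i /h /eqP.
  rewrite mul1r addn0 (eq_bigl (pred1 mu)).
    rewrite -big_filter filter_pred1_uniq ?uniq_box ?big_seq1 //.
    apply/box_nthP; split => // i.
    by move: (dec_le dmu (leq0n i)); lia.
  move=> lam /=; apply/andP/eqP => [[h /eqP e]|->]; first exact: hstrip_sumn_eq.
  by rewrite hstrip_refl.
case: L kL smu hM IH => // L kL smu hM IH.
have mu0 : (nth 0 mu 0 <= M)%N by lia.
transitivity (\sum_(nu <- box L.+1 M)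
    (x k ^+ (sumn mu + m - sumn nu) * gs x k nu) *+
    count (fun kap => [&& hstrip mu kap, hstrip nu kap & sumn nu <= sumn kap + m]%N)
      (box L.+1 M)); last first.
  rewrite [RHS]big_seq_cond.
  under [RHS]eq_bigr => lam.
    move=> /andP[/box_nthP[sl hl] _]; rewrite (gsS _ _ (hl 0%N)) sl; over.
  rewrite -big_seq_cond (exchange_big_dep xpredT) //=; apply: eq_big_seq => nu hnu.
  have [snu _] := box_nthP _ _ _ hnu.
  have [h|nuL] := posnP (nth 0%N nu L); last first.
    rewrite (@gs_vanish _ x k nu L) // mulr0 mul0rn big1 // => i _.
    by rewrite mulr0.
  rewrite -(@count_strips L M m) //.
  transitivity (\sum_(i <- box L.+1 M |
     [&& hstrip i mu, sumn i == sumn mu + m & hstrip i nu]%N)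
      x k ^+ (sumn mu + m - sumn nu) * gs x k nu).
    by rewrite sum_const_count.
  by apply: eq_big => [i|i /and3P[_ /eqP -> _]] //; rewrite andbA.
rewrite (gsS _ _ mu0) smu /= big_distrlr /= exchange_big /=.
transitivity (\sum_(kap <- box L.+1 M | hstrip mu kap)
   \sum_(nu <- box L.+1 M | hstrip nu kap && (sumn nu <= sumn kap + m)%N)
     x k ^+ (sumn mu + m - sumn nu) * gs x k nu); last first.
  rewrite (exchange_big_dep xpredT) //=; apply: eq_bigr => nu _.
  by rewrite sum_const_count.
apply: eq_bigr => kap hk; have hks := hstrip_sumn hk.
have kap0 : (nth 0 kap 0 <= nth 0 mu 0)%N by case/hstripP: hk => _ /(_ 0%N)/andP[].
under eq_bigr => j _.
  rewrite mulrACA -exprD IH ?(hstrip_size hk) //; first last.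
  - by move: (ltn_ord j); lia.
  - exact: hstrip_dec2 hk.
  - by lia.
  rewrite mulr_sumr; over.
rewrite (exchange_big_dep xpredT) //= [RHS]big_mkcond /=.
apply: eq_bigr => nu _; case: (boolP (hstrip nu kap)) => hn /=; last by rewrite big_pred0.
have hns := hstrip_sumn hn.
case: leqP => hm; last first.
  by rewrite big_pred0 // => j; apply/eqP; move: (ltn_ord j); lia.
(* The exponent [j] taken from [hsym] is forced by [sumn nu = sumn kap + (m - j)]. *)
have hj : (m - (sumn nu - sumn kap) < m.+1)%N by lia.
rewrite (big_pred1 (Ordinal hj)) => [|j /=].
  by congr (_ ^+ _ * _) => /=; lia.
by rewrite -val_eqE /=; move: (ltn_ord j) => hj'; apply/eqP/eqP; lia.
Qed.
End Pieri.

(** * Spans of Schur functions avoiding a cell *)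

Section Span.
Variables (R : comNzRingType) (x : nat -> R) (k L : nat).
Hypothesis kL : k <= L.
Local Open Scope ring_scope.
Local Notation G := (gs x k).

Inductive gspan (P : seq nat -> Prop) : R -> Prop :=
| gspan0 : gspan P 0
| gspanS c l f : P l -> gspan P f -> gspan P (G l *~ c + f).

Lemma gspanD P f g : gspan P f -> gspan P g -> gspan P (f + g).
Proof. by elim=> [|c l f' Pl _ IH] h; rewrite ?add0r // -addrA; apply: gspanS; auto. Qed.

Lemma gspanZ P f c : gspan P f -> gspan P (f *~ c).
Proof.
elim=> [|d l f' Pl _ IH]; first by rewrite mul0rz; apply: gspan0.
by rewrite mulrzDl -mulrzA; apply: gspanS.
Qed.

Lemma gspanN P f : gspan P f -> gspan P (- f).
Proof. by move=> h; rewrite -[f]mulr1z -mulrNz; apply: gspanZ. Qed.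

Lemma gspan_gen (P : seq nat -> Prop) l : P l -> gspan P (G l).
Proof.
by move=> Pl; rewrite -[G l]mulr1z -[_ *~ _]addr0; apply: gspanS => //; apply: gspan0.
Qed.

Lemma gspan_sum P (I : eqType) (s : seq I) (Q : pred I) (F : I -> R) :
  (forall i, i \in s -> Q i -> gspan P (F i)) -> gspan P (\sum_(i <- s | Q i) F i).
Proof.
move=> h; rewrite big_seq_cond; apply: (big_ind (gspan P)) => [||i /andP[]]; auto.
- exact: gspan0.
- exact: gspanD.
Qed.

(** The target [Q] is abstract because both [gspan] and [hmul] occur in its place. *)
Lemma gspan_lin (P : seq nat -> Prop) (Q : R -> Prop) f h :
  Q 0 -> (forall f g, Q f -> Q g -> Q (f + g)) -> (forall f c, Q f -> Q (f *~ c)) ->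
  (forall l, P l -> Q (h * G l)) -> gspan P f -> Q (h * f).
Proof.
move=> Q0 QD QZ hl; elim=> [|c l f' Pl _ IH]; first by rewrite mulr0.
by rewrite mulrDr mulrzAr; apply: QD => //; apply: QZ; apply: hl.
Qed.

Lemma gspan_mul (P P' Q : seq nat -> Prop) f g :
  (forall l l', P l -> P' l' -> gspan Q (G l * G l')) ->
  gspan P f -> gspan P' g -> gspan Q (f * g).
Proof.
have lin P0 h0 f0 := @gspan_lin P0 (gspan Q) f0 h0 (gspan0 Q) (@gspanD Q) (@gspanZ Q).
move=> h hf hg; apply: (lin _ _ _ _ hg) => l' Pl'; rewrite mulrC.
by apply: (lin _ _ _ _ hf) => l Pl; rewrite mulrC; apply: h.
Qed.

(** [gspan (hook b a)] is the space H(b,a); rows are numbered from 0. *)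
Definition hook (b a : nat) (l : seq nat) : Prop :=
  [/\ size l = L, dec l & (nth 0 l b <= a)%N].

Lemma hook_hsym b a m f : gspan (hook b a) f -> gspan (hook b.+1 a) (hsym x k m * f).
Proof.
apply: gspan_lin; [exact: gspan0|exact: gspanD|exact: gspanZ|].
move=> mu [smu dmu hb]; rewrite (pieri _ kL smu dmu (leqnn _)).
apply: gspan_sum => lam /box_nthP[sl _] /andP[hl _]; apply: gspan_gen; split => //.
  exact: hstrip_dec1 hl.
by case/hstripP: hl => _ /(_ b)/andP[h _]; apply: leq_trans h hb.
Qed.

Inductive hmul (Q : R -> Prop) : R -> Prop :=
| hmul0 : hmul Q 0
| hmulS m f g : Q f -> hmul Q g -> hmul Q (hsym x k m * f + g).

Lemma hmulD Q f g : hmul Q f -> hmul Q g -> hmul Q (f + g).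
Proof. by elim=> [|m f' g' Qf _ IH] h; rewrite ?add0r // -addrA; apply: hmulS; auto. Qed.

Lemma hmulZ P f c : hmul (gspan P) f -> hmul (gspan P) (f *~ c).
Proof.
elim=> [|m f' g' Pl _ IH]; first by rewrite mul0rz; apply: hmul0.
by rewrite mulrzDl -mulrzAr; apply: hmulS => //; apply: gspanZ.
Qed.

(** Induction on the number of cells below the first row. Let [mu] be [lam] without its first row.
    Every [kap] in the Pieri expansion of h_(lam_0) s_mu satisfies [kap_(i+1) <= mu_i = lam_(i+1)],
    so it stays in [hook b.+1 a]; if [kap] differs from [lam], its first row is longer and the
    measure drops. *)
Lemma hook_row b a lam : hook b.+1 a lam -> hmul (gspan (hook b a)) (G lam).
Proof.
have [n] := ubnP (sumn lam - nth 0 lam 0)%N.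
elim: n lam => // n IH lam hn [sl dl hb].
pose mu := mkseq (fun i => nth 0%N lam i.+1) L.
have smu : size mu = L by rewrite size_mkseq.
have nmu i : nth 0%N mu i = nth 0%N lam i.+1.
  have [iL|iL] := ltnP i L; first by rewrite nth_mkseq.
  by rewrite !nth_default ?smu ?sl // ltnW.
have dmu : dec mu by move=> i; rewrite !nmu.
have summu : (sumn mu + nth 0 lam 0 = sumn lam)%N.
  rewrite (sumn_nth smu) (sumn_nth sl).
  transitivity (\sum_(i < L.+1) nth 0 lam i)%N; last first.
    by rewrite big_ord_recr /= [nth _ _ L]nth_default ?addn0 ?sl.
  by rewrite big_ord_recl /= addnC; congr (_ + _)%N; apply: eq_bigr => i _; rewrite nmu.
have P := pieri x kL smu dmu (leqnn (nth 0 mu 0 + nth 0 lam 0)%N).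
rewrite summu in P.
have hlm : hstrip lam mu.
  by apply/hstripP; rewrite smu sl; split => // i; rewrite nmu leqnn dl.
have hin : lam \in [seq l <- box L (nth 0 mu 0 + nth 0 lam 0)
                     | hstrip l mu && (sumn l == sumn lam)%N].
  rewrite mem_filter hlm eqxx /=; apply/box_nthP; split => // i.
  by apply: leq_trans (dec_le dl (leq0n i)) _; rewrite leq_addl.
rewrite -big_filter (bigD1_seq lam) ?filter_uniq ?uniq_box //= in P.
rewrite big_filter_cond /= in P.
have -> : G lam = hsym x k (nth 0%N lam 0) * G mu + (G lam - hsym x k (nth 0%N lam 0) * G mu).
  by rewrite addrC subrK.
apply: hmulS.
  by apply: gspan_gen; split => //; rewrite nmu.
rewrite P opprD addrA subrr add0r -[X in - X]mulr1z -mulrNz; apply: hmulZ.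
rewrite big_seq_cond.
apply: (big_ind (hmul (gspan (hook b a)))) => [|f g|kap].
- exact: hmul0.
- exact: hmulD.
case/and3P => /box_nthP[sk _] /andP[hk /eqP sumk] nk.
have dk := hstrip_dec1 hk; have /hstripP[_ hk'] := hk.
have kl i : (nth 0 kap i.+1 <= nth 0 lam i.+1)%N by rewrite -nmu; case/andP: (hk' i).
(* Otherwise [kap] would lie inside [lam] and have the same size, hence equal it. *)
have k0 : (nth 0 lam 0 < nth 0 kap 0)%N.
  rewrite ltnNge; apply: contra nk => k0; apply/eqP/esym; apply: le_sumn_eq.
  - by rewrite sl.
  - by case.
  - by rewrite sumk.
have lk : (nth 0 kap 0 <= sumn kap)%N.
  by case: (kap) => //= c s; rewrite leq_addr.
apply: IH.
  by rewrite sumk; move: lk; rewrite sumk; lia.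
by split => //; apply: leq_trans (kl b) hb.
Qed.

Lemma hook_decomp b a f : gspan (hook b.+1 a) f -> hmul (gspan (hook b a)) f.
Proof.
move=> hf; rewrite -[f]mul1r; apply: (gspan_lin (Q := hmul (gspan (hook b a))) _ _ _ _ hf).
- exact: hmul0.
- exact: hmulD.
- by move=> g c; apply: hmulZ.
by move=> l hl; rewrite mul1r; apply: hook_row.
Qed.

(** Extracting a factor h_m from either argument lowers its [b] by one, and multiplying the product
    by h_m raises the sum back by one. The base case stays a hypothesis because it is supplied
    twice: for [a1 = a2 = 0], and then in general. *)
Lemma hook_mul_of_base a1 a2 :
  (forall f g, gspan (hook 0 a1) f -> gspan (hook 0 a2) g ->
     gspan (hook 0 (a1 + a2)) (f * g)) ->
  forall b1 b2 f g, gspan (hook b1 a1) f -> gspan (hook b2 a2) g ->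
     gspan (hook (b1 + b2) (a1 + a2)) (f * g).
Proof.
move=> base; elim=> [|b1 IH1] b2 f g hf hg; last first.
  elim: (hook_decomp hf) => [|m f' g' hf' _ IH]; first by rewrite mul0r; apply: gspan0.
  rewrite mulrDl -mulrA; apply: gspanD => //.
  by rewrite addSn; apply: hook_hsym; apply: IH1.
elim: b2 g hg => [|b2 IH] g hg; first exact: base.
elim: (hook_decomp hg) => [|m f' g' hf' _ IHg]; first by rewrite mulr0; apply: gspan0.
rewrite mulrDr mulrCA; apply: gspanD => //.
by rewrite add0n; apply: hook_hsym; apply: IH.
Qed.

Lemma gs_zero n : gs x n (nseq L 0%N) = 1.
Proof.
elim: n => [|n IH]; first by rewrite /= all_nseq orbT.
have n0 i : nth 0%N (nseq L 0%N) i = 0%N by rewrite nth_nseq if_same.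
rewrite (@gsS _ x 0) ?n0 // size_nseq -big_filter.
rewrite (eq_in_filter (a2 := pred1 (nseq L 0%N))) => [|m].
  rewrite filter_pred1_uniq ?uniq_box ?big_seq1 ?subnn ?mul1r //.
  by apply/box_nthP; rewrite size_nseq; split => // i; rewrite n0.
case/box_nthP => sm hm /=; apply/idP/eqP => [_|->].
  apply: (@eq_from_nth _ 0%N) => [|i _]; first by rewrite size_nseq.
  by rewrite n0; apply/eqP; rewrite -leqn0.
by apply: hstrip_refl => i; rewrite !n0.
Qed.

(** The only shape in [hook 0 0] is the zero list, so the base case reads 1 * 1 = 1. For
    [b1, b2 >= L] this says that products of Schur polynomials are integral combinations of Schur
    polynomials. *)
Lemma hook_mul0 b1 b2 f g : gspan (hook b1 0) f -> gspan (hook b2 0) g ->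
     gspan (hook (b1 + b2) 0) (f * g).
Proof.
apply: (@hook_mul_of_base 0 0) => {}f {}g; apply: gspan_mul => l l'.
have Z m : hook 0 0 m -> m = nseq L 0%N.
  case=> sm dm h; apply: (@eq_from_nth _ 0%N) => [|i _]; first by rewrite size_nseq.
  by rewrite nth_nseq if_same; move: (dec_le dm (leq0n i)); lia.
move=> /[dup] /Z -> h /Z ->; rewrite gs_zero mulr1 -(gs_zero k).
exact: gspan_gen.
Qed.

End Span.

(** * Leading terms and linear independence *)

Lemma sumn_supp k m : (forall i, k <= i -> nth 0 m i = 0) ->
  sumn m = \sum_(i < k) nth 0 m i.
Proof.
elim: m k => [|a m IH] k h /=; first by rewrite big1 // => i _; rewrite nth_nil.
case: k h => [|k] h.
  rewrite big_ord0 (IH 0) => [|i _]; last exact: (h i.+1).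
  by rewrite big_ord0; have /= -> := h 0 isT.
by rewrite big_ord_recl (IH k) // => i ki; apply: (h i.+1).
Qed.

Section LeadSchur.
Local Open Scope ring_scope.

(** With strictly decreasing weights, the dominant monomial of s_l is x^l, and its coefficient is
    1. *)
Lemma gs_lead (w : nat -> nat) k l :
  (forall i j, (i < j < k)%N -> (w j < w i)%N) -> dec l ->
  (forall i, (k <= i)%N -> nth 0%N l i = 0%N) ->
  let p := gs (fun i => 'X^(w i) : {poly int}) k l in
  size p = (\sum_(i < k) nth 0 l i * w i).+1 /\ p \is monic.
Proof.
elim: k l => [|k IH] l hw dl hl p.
  rewrite {}/p /= big_ord0.
  have -> : all (eq_op 0%N) l by apply/(all_nthP 0%N) => i _; rewrite hl.
  by rewrite size_poly1 monic1.
have {}IH := IH _ (fun i j ij => hw i j (introT andP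
   (conj (proj1 (andP ij)) (leqW (proj2 (andP ij)))))).
(* The dominant strip removes only row [k], leaving as many cells as possible to the heavier
   variables; [D m] below is the degree of the term of [m]. *)
pose l' := mkseq (fun i => if (i < k)%N then nth 0%N l i else 0%N) (size l).
have nl' i : nth 0%N l' i = if (i < k)%N then nth 0%N l i else 0%N.
  have [iL|iL] := ltnP i (size l); first by rewrite nth_mkseq.
  by rewrite !nth_default ?size_mkseq // if_same.
have hl' : hstrip l l'.
  apply/hstripP; rewrite size_mkseq; split=> // i; rewrite nl'.
  by case: ltnP => ik; [rewrite dl leqnn|rewrite hl ?ltnS].
pose D m := (w k * (sumn l - sumn m) + \sum_(i < k) nth 0 m i * w i)%N.
have sl := sumn_supp hl; rewrite big_ord_recr /= in sl.
have zl' i : (k <= i)%N -> nth 0%N l' i = 0%N by move=> ki; rewrite nl' ltnNge ki.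
have El' : \sum_(i < k) nth 0%N l' i = \sum_(i < k) nth 0%N l i.
  by apply: eq_bigr => i _; rewrite nl' ltn_ord.
have Dl' : D l' = (\sum_(i < k.+1) nth 0 l i * w i)%N.
  rewrite /D big_ord_recr /= (sumn_supp zl') sl El' addnC addKn mulnC; congr (_ + _)%N.
  by apply: eq_bigr => i _; rewrite nl' ltn_ord.
have szT m : (forall i, (k <= i)%N -> nth 0%N m i = 0%N) -> dec m ->
    size ('X^(w k) ^+ (sumn l - sumn m) * gs (fun i => 'X^(w i) : {poly int}) k m)
      = (D m).+1 /\
    'X^(w k) ^+ (sumn l - sumn m) * gs (fun i => 'X^(w i) : {poly int}) k m \is monic.
  move=> zm dm; have [s1 m1] := IH m dm zm.
  split; last by rewrite monicMl // -exprM monicXn.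
  by rewrite mulrC -exprM size_mulXn ?monic_neq0 // s1 /D addnS.
have inb : l' \in [seq m <- box (size l) (nth 0%N l 0) | hstrip l m].
  rewrite mem_filter hl'; apply/box_nthP; rewrite size_mkseq; split=> // i.
  by rewrite nl'; case: ifP => // _; apply: dec_le.
have [sl1 ml1] := szT l' zl' (hstrip_dec2 hl').
rewrite {}/p /= -big_filter (bigD1_seq l') ?filter_uniq ?uniq_box //= big_filter_cond.
set q := \sum_(_ <- _ | _) _.
suff sq : (size q < (D l').+1)%N.
  rewrite size_polyDl ?sl1 // Dl'; split=> //.
  by rewrite monicE lead_coefDl ?sl1 // -monicE.
rewrite ltnS /q big_seq_cond; apply: (big_ind (fun f : {poly int} => size f <= D l')%N).
- by rewrite size_poly0.
- by move=> f g hf hg; rewrite (leq_trans (size_polyD _ _)) // geq_max hf.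
move=> m /and3P[/box_nthP[sm _] hm nm].
case: (boolP (all (fun i => (k <= i)%N ==> (nth 0%N m i == 0%N)) (iota 0 (size m)))); last first.
  case/allPn => i _; rewrite negb_imply -lt0n => /andP[ki hi].
  by rewrite (gs_vanish _ ki hi) mulr0 size_poly0.
move=> /allP zm0.
have zm i : (k <= i)%N -> nth 0%N m i = 0%N.
  have [im|im] := ltnP i (size m); last by rewrite nth_default.
  by move=> ki; have := zm0 i; rewrite mem_iota ki => /(_ im)/eqP.
have [-> _] := szT m zm (hstrip_dec2 hm).
case/hstripP: hm => _ hm.
have ml i : (nth 0 m i <= nth 0 l i)%N by case/andP: (hm i).
have [i0 hi0] : exists i : 'I_k, (nth 0 m i < nth 0 l i)%N.
  apply/existsP; apply: contraR nm; rewrite negb_exists => /forallP h.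
  apply/eqP/(@eq_from_nth _ 0%N) => [|i _]; first by rewrite size_mkseq.
  rewrite nl'; case: ltnP => ik; last exact: zm.
  by have := h (Ordinal ik); rewrite -leqNgt /= => h'; apply/eqP; rewrite eqn_leq ml h'.
rewrite Dl' /D big_ord_recr /= sl (sumn_supp zm).
pose d (i : 'I_k) := (nth 0 l i - nth 0 m i)%N.
have E1 : (\sum_(i < k) nth 0 l i = \sum_(i < k) nth 0 m i + \sum_(i < k) d i)%N.
  by rewrite -big_split; apply: eq_bigr => i _; rewrite /d /= subnKC.
have E2 : (\sum_(i < k) nth 0 l i * w i = \sum_(i < k) nth 0 m i * w i + \sum_(i < k) d i * w i)%N.
  by rewrite -big_split; apply: eq_bigr => i _; rewrite /= -mulnDl /d subnKC.
(* Each cell removed from a row [i < k] trades the weight [w i] for the smaller [w k], and row [i0]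
   loses at least one cell. *)
have E3 : (w k * \sum_(i < k) d i < \sum_(i < k) d i * w i)%N.
  rewrite big_distrr /= (bigD1 i0) // [X in (_ < X)%N](bigD1 i0) //= -addSn leq_add //.
    by rewrite mulnC ltn_pmul2l ?subn_gt0 // hw // ltn_ord /=.
  by apply: leq_sum => i _; rewrite mulnC leq_mul2l ltnW ?orbT // hw // ltn_ord /=.
rewrite E1 E2.
rewrite -addnA addKn mulnDr [(nth 0%N l k * _)%N]mulnC; move: E3; clear.
move: (\sum_(i < k) d i * w i)%N (w k * \sum_(i < k) d i)%N (w k * nth 0 l k)%N
  (\sum_(i < k) nth 0 m i * w i)%N => *; lia.
Qed.

End LeadSchur.

Lemma seq_max_ex (T : eqType) (d : T -> nat) (s : seq T) (a : T) : a \in s ->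
  exists2 b, b \in s & forall c, c \in s -> d c <= d b.
Proof.
elim: s a => // e s IH a _; case: s IH => [|e' s] IH.
  by exists e; rewrite ?mem_head // => c; rewrite inE => /eqP ->.
have [b bs hb] := IH e' (mem_head _ _).
have [h|h] := leqP (d e) (d b).
  by exists b => [|c]; rewrite inE ?bs ?orbT // => /orP[/eqP ->|/hb].
exists e => [|c]; first exact: mem_head.
by rewrite inE => /orP[/eqP ->|/hb h'] //; apply: leq_trans h' (ltnW h).
Qed.

Section Lead.
Local Open Scope ring_scope.

(** Among the terms with nonzero coefficient, the one of largest degree is alone in that degree, so
    it survives in the sum. *)
Lemma lead_bound (T : eqType) (s : seq T) (P : T -> {poly int}) (d : T -> nat)
    (c : T -> int) :
  uniq s ->
  (forall i, i \in s -> c i != 0 -> size (P i) = (d i).+1 /\ P i \is monic) ->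
  (forall i j, i \in s -> j \in s -> c i != 0 -> c j != 0 -> d i = d j -> i = j) ->
  forall i, i \in s -> c i != 0 -> (d i < size (\sum_(j <- s) P j *~ c j)%R)%N.
Proof.
move=> us hP inj i si ci.
have [i0 i0s hi0] : exists2 b, b \in [seq j <- s | c j != 0] &
    forall j, j \in [seq j <- s | c j != 0] -> (d j <= d b)%N.
  by apply: (@seq_max_ex _ d _ i); rewrite mem_filter ci.
move: i0s; rewrite mem_filter => /andP[ci0 si0].
have {hi0} hi0 j : j \in s -> c j != 0 -> (d j <= d i0)%N.
  by move=> sj cj; apply: hi0; rewrite mem_filter cj.
apply: leq_ltn_trans (hi0 i si ci) _; rewrite ltnNge; apply: contra (ci0) => h.
have := nth_default 0 h; rewrite coef_sum (bigD1_seq i0) //= big1_seq => [|j].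
  have [s0 /monicP] := hP i0 si0 ci0.
  rewrite /lead_coef s0 /= -[X in X + _]/(coefp _ _) raddfMz /= => ->.
  by rewrite addr0 intz => ->.
case/andP => ji0 sj; case: (eqVneq (c j) 0) => [->|cj]; first by rewrite mulr0z coef0.
have [sz _] := hP j sj cj.
rewrite -[LHS]/(coefp _ _) raddfMz /= nth_default ?mul0rz // sz ltn_neqAle hi0 // andbT.
by apply: contra ji0 => /eqP e; apply/eqP; apply: inj.
Qed.
End Lead.

(** The base-[B] numeral with digits [f 0, ..., f (N-1)], most significant first, so that comparing
    numerals compares first rows first. *)
Definition digits (B N : nat) (f : nat -> nat) : nat :=
  \sum_(i < N) f i * B ^ (N.-1 - i).

Lemma digitsSr B N f : digits B N.+1 f = digits B N f * B + f N.
Proof.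
rewrite /digits big_ord_recr /= subnn muln1 big_distrl /=; congr (_ + _).
apply: eq_bigr => i _; rewrite -mulnA -expnSr; congr (_ * _ ^ _).
by move: (ltn_ord i); lia.
Qed.

Lemma digitsSl B N f : digits B N.+1 f = f 0 * B ^ N + digits B N (fun i => f i.+1).
Proof.
rewrite /digits big_ord_recl /= subn0; congr (_ + _); apply: eq_bigr => i _.
by rewrite /bump add1n; congr (_ * _ ^ _); lia.
Qed.

Lemma digits_lt B N f : (forall i, f i < B) -> digits B N f < B ^ N.
Proof.
move=> h; elim: N => [|N IH]; first by rewrite /digits big_ord0.
by rewrite digitsSr expnSr; have := h N; nia.
Qed.

Lemma digits_inj B N f g : (forall i, f i < B) -> (forall i, g i < B) ->
  digits B N f = digits B N g -> forall i, i < N -> f i = g i.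
Proof.
move=> hf hg; elim: N => [|N IH] //; rewrite !digitsSr => e i.
have B0 : 0 < B by apply: leq_ltn_trans (hf 0).
have eN : f N = g N.
  by have := congr1 (modn^~ B) e; rewrite !modnMDl !modn_small.
have eD : digits B N f = digits B N g.
  by have := congr1 (divn^~ B) e; rewrite !divnMDl // !divn_small // !addn0.
by rewrite ltnS leq_eqVlt => /orP[/eqP ->|] //; apply: IH.
Qed.

Lemma digitsD B N f g : digits B N (fun i => f i + g i) = digits B N f + digits B N g.
Proof. by rewrite /digits -big_split; apply: eq_bigr => i _; rewrite mulnDl. Qed.

(** * Specialization to one variable, independence, and the product theorem *)

Section Morph.
Local Open Scope ring_scope.

Lemma gs_ext (R : comNzRingType) (x y : nat -> R) k l :
  (forall i, (i < k)%N -> x i = y i) -> gs x k l = gs y k l.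
Proof.
elim: k l => [|k IH] l h //=; apply: eq_bigr => m _.
by rewrite h // IH // => i ik; apply: h; apply: ltnW.
Qed.

Lemma gs_morph (R S : comNzRingType) (phi : {rmorphism R -> S}) (x : nat -> R) k l :
  phi (gs x k l) = gs (phi \o x) k l.
Proof.
elim: k l => [|k IH] l /=; first by rewrite rmorph_nat.
by rewrite rmorph_sum; apply: eq_bigr => m _; rewrite rmorphM rmorphXn /= IH.
Qed.

Lemma gspan_expand (R : comNzRingType) (x : nat -> R) k P f : gspan x k P f ->
  exists (s : seq (seq nat)) (d : seq nat -> int),
   [/\ uniq s, forall l, l \in s -> P l & f = \sum_(l <- s) gs x k l *~ d l].
Proof.
elim=> [|c l {}f Pl _ [s [d [us sP ->]]]].
  by exists [::], (fun=> 0); split; rewrite ?big_nil.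
have [ls|ls] := boolP (l \in s).
  exists s, (fun m => d m + (if m == l then c else 0)); split => //.
  under [RHS]eq_bigr do rewrite mulrzDr.
  rewrite big_split /= addrC; congr (_ + _).
  rewrite (bigD1_seq l) //= eqxx big1 ?addr0 // => m /negbTE ->.
  by rewrite mulr0z.
exists (l :: s), (fun m => if m == l then c else d m); split.
- by rewrite /= ls.
- by move=> m; rewrite inE => /orP[/eqP ->|/sP].
- rewrite big_cons eqxx; congr (_ + _); apply: eq_big_seq => m ms.
  by case: eqVneq => // e; rewrite -e ms in ls.
Qed.

Variable N : nat.

Definition mvar (i : nat) : {mpoly int[N]} :=
  if insub i is Some j then 'X_(j : 'I_N) else 0.

(* For B large, the degree of the image of s_lam under X_i |-> X^(B^(N-1-i)) encodes lam. *)
Definition spec (B : nat) : {mpoly int[N]} -> {poly int} :=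
  mmap (polyC : int -> {poly int}) (fun i : 'I_N => 'X^(B ^ (N.-1 - i))).

HB.instance Definition _ B := GRing.RMorphism.copy (spec B)
  (mmap (polyC : int -> {poly int}) (fun i : 'I_N => 'X^(B ^ (N.-1 - i)))).

Lemma spec_gs B l :
  spec B (gs mvar N l) = gs (fun i => 'X^(B ^ (N.-1 - i))) N l.
Proof.
rewrite gs_morph; apply: gs_ext => i iN.
by rewrite /= /mvar insubT /spec mmapX mmap1U.
Qed.

Definition isdec L l := size l = L /\ dec l.

Lemma spec_lead B l : (1 < B)%N -> dec l -> nth 0%N l N = 0%N ->
  size (spec B (gs mvar N l)) = (digits B N (nth 0%N l)).+1 /\
  spec B (gs mvar N l) \is monic.
Proof.
move=> B1 dl lN; rewrite spec_gs; apply: gs_lead => //.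
  by move=> i j /andP[ij jk]; rewrite ltn_exp2l //; lia.
by move=> i Ni; move: (dec_le dl Ni); lia.
Qed.

Lemma digits_isdec_inj B L l m : isdec L l -> isdec L m ->
  nth 0%N l N = 0%N -> nth 0%N m N = 0%N ->
  (forall i, nth 0 l i < B)%N -> (forall i, nth 0 m i < B)%N ->
  digits B N (nth 0%N l) = digits B N (nth 0%N m) -> l = m.
Proof.
move=> [sl dl] [sm dm] lN mN hl hm e.
apply: (@eq_from_nth _ 0%N) => [|i _]; first by rewrite sl.
have [iN|Ni] := ltnP i N; first exact: (digits_inj hl hm e).
by move: (dec_le dl Ni) (dec_le dm Ni); lia.
Qed.

(** Shapes with more than [N] rows contribute 0 and are discarded; the others have all entries below
    [B], so distinct shapes have distinct degrees and [lead_bound] applies. *)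
Lemma spec_bound B L s (d : seq nat -> int) : (1 < B)%N ->
  uniq s -> (forall l, l \in s -> isdec L l) ->
  (forall l i, l \in s -> nth 0 l i < B)%N ->
  forall l, l \in s -> nth 0%N l N = 0%N -> d l != 0 ->
  (digits B N (nth 0%N l) < size (spec B (\sum_(m <- s) gs mvar N m *~ d m)%R))%N.
Proof.
move=> B1 us sd sB l ls lN dl.
rewrite rmorph_sum /=; under eq_bigr do rewrite rmorphMz /=.
pose s' := [seq m <- s | nth 0%N m N == 0%N].
have -> : \sum_(m <- s) spec B (gs mvar N m) *~ d m =
          \sum_(m <- s') spec B (gs mvar N m) *~ d m.
  rewrite big_filter [RHS]big_mkcond; apply: eq_bigr => m _.
  case: posnP => // h; rewrite (gs_vanish _ (leqnn N) h).
  by rewrite rmorph0 mul0rz.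
apply: (@lead_bound _ s' _ (fun l => digits B N (nth 0%N l)) d) => //.
- exact: filter_uniq.
- move=> m; rewrite mem_filter => /andP[/eqP mN ms] _.
  by apply: spec_lead => //; case: (sd m ms).
- move=> m n; rewrite !mem_filter => /andP[/eqP mN ms] /andP[/eqP nN ns] _ _.
  by apply: (@digits_isdec_inj _ L); auto.
- by rewrite mem_filter lN eqxx.
Qed.

Lemma nth_le_sumn l i : (nth 0 l i <= sumn l)%N.
Proof.
elim: l i => [|a l IH] [|i] //=; first by rewrite leq_addr.
by apply: leq_trans (IH i) _; rewrite leq_addl.
Qed.

(** The two extra units make the base exceed every entry and also 1, which keeps the weights
    [B ^ (N.-1 - i)] strictly decreasing. *)
Definition bnd (s : seq (seq nat)) := (\sum_(l <- s) sumn l).+2.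

Lemma bndP s l i : l \in s -> (nth 0 l i < bnd s)%N.
Proof.
move=> ls; rewrite /bnd ltnS; apply: leq_trans (nth_le_sumn l i) _.
by rewrite (big_rem l) //= -addnS leq_addr.
Qed.

(** Moving the term of [lam] to the other side gives a vanishing combination with coefficient [- c]
    at [lam]; for [c != 0], [spec_bound] would give it positive size. *)
Lemma gs_indep L lam (c : int) : isdec L lam -> nth 0%N lam N = 0%N ->
  gspan mvar N (fun l => isdec L l /\ l != lam) (gs mvar N lam *~ c) -> c = 0.
Proof.
move=> dlam lamN /gspan_expand[s [d [us sP e]]]; apply/eqP/negPn/negP => c0.
have ls : lam \notin s by apply/negP => /sP[_]; rewrite eqxx.
have := @spec_bound (bnd (lam :: s)) L (lam :: s) (fun l => if l == lam then - c else d l)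
  isT _ _ _ lam (mem_head _ _) lamN.
rewrite eqxx oppr_eq0 => /(_ _ _ _ c0); rewrite /= ls us => h.
have {h} := h isT; rewrite big_cons eqxx mulrNz e.
have -> : \sum_(j <- s) gs mvar N j *~ (if j == lam then - c else d j) =
          \sum_(l <- s) gs mvar N l *~ d l.
  apply: eq_big_seq => m ms; case: eqVneq => // em.
  by rewrite -em ms in ls.
rewrite addNr rmorph0 size_poly0 ltn0 => h; suff : false by [].
apply: h => // [l|l i]; last exact: bndP.
by rewrite inE => /orP[/eqP ->|/sP[]].
Qed.

(** [hook_mul0] with [b = L] provides some Schur expansion of the product. By [spec_bound], no shape
    occurring in it has a degree above that of the product, which is the sum of the degrees of the
    factors; the leading digits then give [l_0 <= mu_0 + nu_0]. *)
Lemma gs_mul_row0 L mu nu a1 a2 : (N <= L)%N ->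
  hook L 0 a1 mu -> hook L 0 a2 nu ->
  gspan mvar N (hook L 0 (a1 + a2)) (gs mvar N mu * gs mvar N nu).
Proof.
move=> NL [smu dmu hmu] [snu dnu hnu].
have [muN|muN] := posnP (nth 0%N mu N); last first.
  by rewrite (gs_vanish _ (leqnn N) muN) mul0r; apply: gspan0.
have [nuN|nuN] := posnP (nth 0%N nu N); last first.
  by rewrite (gs_vanish _ (leqnn N) nuN) mulr0; apply: gspan0.
have : gspan mvar N (hook L (L + L) 0) (gs mvar N mu * gs mvar N nu).
  apply: hook_mul0 => //; apply: gspan_gen; split => //.
    by rewrite nth_default ?smu.
  by rewrite nth_default ?snu.
move=> /gspan_expand[s [d [us sP e]]]; rewrite e.
apply: gspan_sum => l ls _.
case: (eqVneq (d l) 0) => [->|dl]; first by rewrite mulr0z; apply: gspan0.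
have [lN|lN] := posnP (nth 0%N l N); last first.
  by rewrite (gs_vanish _ (leqnn N) lN) mul0rz; apply: gspan0.
apply: gspanZ; apply: gspan_gen; have [sl decl _] := sP l ls; split => //.
case: (posnP N) => [N0|N0]; first by move: lN; rewrite N0 => ->.
(* Also larger than every [mu_i + nu_i], so the lower digits of the sum do not carry into the
   leading one. *)
pose B := (bnd s + sumn mu + sumn nu)%N.
have B1 : (1 < B)%N by rewrite /B /bnd.
have := @spec_bound B L s d B1 us _ _ l ls lN dl; rewrite -e rmorphM /=.
have [s1 m1] := spec_lead B1 dmu muN; have [s2 m2] := spec_lead B1 dnu nuN.
rewrite size_mul ?monic_neq0 // s1 s2 addSn /= addnS ltnS -digitsD => h.
have {}h : (digits B N (nth 0 l) <= digits B N (fun i => nth 0 mu i + nth 0 nu i))%N.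
  apply: h => [m /sP[]|m i ms]; first by [].
  by apply: leq_trans (bndP i ms) _; rewrite /B -addnA leq_addr.
case: (N) N0 h => // n _; rewrite !digitsSl => h.
have lt := @digits_lt B n (fun i => nth 0 mu i.+1 + nth 0 nu i.+1)%N.
have {}lt : (digits B n (fun i => nth 0 mu i.+1 + nth 0 nu i.+1) < B ^ n)%N.
  by apply: lt => i; move: (nth_le_sumn mu i.+1) (nth_le_sumn nu i.+1);
     rewrite /B /bnd; lia.
suff : (nth 0 l 0 < nth 0 mu 0 + nth 0 nu 0 + 1)%N by lia.
rewrite -(@ltn_pmul2r (B ^ n)) ?expn_gt0 ?(ltnW B1) //.
by rewrite mulnDl mul1n; lia.
Qed.

Theorem hook_mul L b1 a1 b2 a2 f g : (N <= L)%N ->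
  gspan mvar N (hook L b1 a1) f -> gspan mvar N (hook L b2 a2) g ->
  gspan mvar N (hook L (b1 + b2) (a1 + a2)) (f * g).
Proof.
move=> NL; apply: hook_mul_of_base => // {}f {}g.
by apply: gspan_mul => l l'; apply: gs_mul_row0.
Qed.
End Morph.

(** * Tableaux *)

Lemma sum_ord_lt B n : n <= B -> \sum_(j < B | j < n) 1 = n.
Proof. by move=> nB; rewrite -(big_ord_widen B (fun=> 1)) // sum1_card card_ord. Qed.

Lemma card_down B (Q : pred 'I_B) :
  (forall j j' : 'I_B, j <= j' -> Q j' -> Q j) -> forall j : 'I_B, (j < #|Q|) = Q j.
Proof.
move=> hQ j; apply/idP/idP => [|Qj]; last first.
  rewrite -[j.+1](@sum_ord_lt B) // sum1_card; apply/subset_leq_card/subsetP => i.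
  by rewrite !unfold_in /= => ij; apply: hQ Qj.
apply: contraLR => nQ; rewrite -leqNgt -[X in _ <= X](@sum_ord_lt B) ?(ltnW (ltn_ord j)) //.
rewrite sum1_card; apply/subset_leq_card/subsetP => i; rewrite !unfold_in => Qi; change (i < j).
by rewrite ltnNge; apply: contra nQ => ji; apply: hQ Qi.
Qed.

Lemma sum_cells A B l : (forall i, A <= i -> nth 0 l i = 0) ->
  (forall i, nth 0 l i <= B) ->
  \sum_(c : 'I_A * 'I_B | indiag l c.2 c.1) 1 = sumn l.
Proof.
move=> hA hB; rewrite (sumn_supp hA).
rewrite -(pair_big_dep xpredT (fun (i : 'I_A) (j : 'I_B) => indiag l j i) (fun _ _ => 1)) /=.
by apply: eq_bigr => i _; rewrite sum_ord_lt.
Qed.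

Section Tableaux.
Variables (A B C : nat) (R : comNzRingType) (x : nat -> R).
Local Notation cell := ('I_A * 'I_B)%type.
Local Notation filling := {ffun 'I_A * 'I_B -> 'I_C.+1}.

(** Branching shrinks both the shape and the alphabet. Keeping the box and the value type fixed, and
    bounding the entries by a predicate, leaves all these tableaux in one type. *)
Definition tabk (k : nat) (l : seq nat) (T : filling) : bool :=
  [&& [forall c : cell, indiag l c.2 c.1 || (nat_of_ord (T c) == 0)],
      [forall c : cell, indiag l c.2 c.1 ==> (T c < k)],
      [forall i : 'I_A, forall j : 'I_B, forall j' : 'I_B,
         ((j < j') && indiag l j' i) ==> (T (i, j) <= T (i, j'))]
    & [forall i : 'I_A, forall i' : 'I_A, forall j : 'I_B,
         ((i < i') && indiag l j i') ==> (T (i, j) < T (i', j))]].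

Lemma tabkP k l (T : filling) : reflect
  [/\ forall c : cell, ~~ indiag l c.2 c.1 -> T c = ord0,
      forall c : cell, indiag l c.2 c.1 -> T c < k,
      forall (i : 'I_A) (j j' : 'I_B), j < j' -> indiag l j' i -> T (i, j) <= T (i, j')
    & forall (i i' : 'I_A) (j : 'I_B), i < i' -> indiag l j i' -> T (i, j) < T (i', j)]
  (tabk k l T).
Proof.
apply: (iffP and4P) => -[h1 h2 h3 h4]; split.
- by move=> c hc; apply/val_inj/eqP; have := forallP h1 c; rewrite (negbTE hc).
- by move=> c; apply/implyP; apply: (forallP h2).
- move=> i j j' jj hj; move/forallP/(_ i)/forallP/(_ j)/forallP/(_ j'): h3.
  by rewrite jj hj.
- move=> i i' j ii hj; move/forallP/(_ i)/forallP/(_ i')/forallP/(_ j): h4.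
  by rewrite ii hj.
- by apply/forallP => c; case: (boolP (indiag _ _ _)) => //= /h1 ->.
- by apply/forallP => c; apply/implyP; apply: h2.
- apply/forallP => i; apply/forallP => j; apply/forallP => j'; apply/implyP.
  by case/andP; apply: h3.
- apply/forallP => i; apply/forallP => i'; apply/forallP => j; apply/implyP.
  by case/andP; apply: h4.
Qed.

Definition tab k l : R :=
  (\sum_(T : filling | tabk k l T) \prod_(c : cell | indiag l c.2 c.1) x (T c))%R.

Section Branch.
Variables (L k : nat) (l : seq nat).
Hypotheses (kC : k <= C) (sl : size l = L) (dl : dec l)
  (lA : forall i, A <= i -> nth 0 l i = 0) (lB : nth 0 l 0 <= B).

Let lBi i : nth 0 l i <= B. Proof. exact: leq_trans (dec_le dl (leq0n i)) lB. Qed.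

Let AL (i : nat) : 0 < nth 0 l i -> i < A.
Proof. by move=> h; rewrite ltnNge; apply: contraL h => /lA ->. Qed.

(** The shape formed by the entries below [k]. Lists have length [L] while the box has [A] rows,
    hence the default 0. *)
Let shape (T : filling) : seq nat :=
  mkseq (fun i => if insub i is Some i' then
     #|[pred j : 'I_B | indiag l j i && (T (i' : 'I_A, j) < k)]| else 0) L.

Let size_shape T : size (shape T) = L. Proof. by rewrite size_mkseq. Qed.

Let nth_shape0 T i : A <= i -> nth 0 (shape T) i = 0.
Proof.
move=> Ai; have [iL|iL] := ltnP i L; last by rewrite nth_default ?size_shape.
by rewrite nth_mkseq // insubN // -leqNgt.
Qed.

Let nth_shape T (i : 'I_A) : nth 0 (shape T) i =
  #|[pred j : 'I_B | indiag l j i && (T (i, j) < k)]|.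
Proof.
have [iL|iL] := ltnP i L.
  rewrite nth_mkseq // insubT //= => ltiA; apply: eq_card => j; rewrite !inE.
  by rewrite (_ : Sub _ _ = i) //; apply: val_inj.
rewrite nth_default ?size_shape //; apply/esym/eqP; rewrite eq_card0 // => j.
by rewrite !inE /indiag (nth_default 0) ?sl.
Qed.

Let shapeE T (i : 'I_A) (j : 'I_B) : tabk k.+1 l T ->
  indiag (shape T) j i = indiag l j i && (T (i, j) < k).
Proof.
case/tabkP => _ _ h3 _; rewrite {1}/indiag nth_shape card_down //.
move=> {}j j' jj' /= /andP[hj' hT]; apply/andP; split.
  by apply: leq_ltn_trans jj' hj'.
move: jj'; rewrite leq_eqVlt => /orP[/eqP/val_inj -> //|jj'].
by apply: leq_ltn_trans (h3 _ _ _ jj' hj') hT.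
Qed.

Let shape_le T i : nth 0 (shape T) i <= nth 0 l i.
Proof.
have [iA|/nth_shape0 -> //] := ltnP i A.
rewrite (nth_shape T (Ordinal iA)) -[X in _ <= X](@sum_ord_lt B) //= sum1_card.
by apply/subset_leq_card/subsetP => j; rewrite !unfold_in /= => /andP[].
Qed.

(** If [l_(i+1)] exceeded row [i] of the shape, some column would carry an entry at least [k] in row
    [i] and a strictly larger one below it, against the bound [k.+1]. *)
Let shape_hstrip T : tabk k.+1 l T -> hstrip l (shape T).
Proof.
move=> hT; apply/hstripP; rewrite size_shape sl; split=> // i.
rewrite shape_le andbT leqNgt; apply/negP => h.
have i1A : i.+1 < A by apply: AL; apply: leq_ltn_trans h.
have jB : nth 0 (shape T) i < B by apply: leq_trans h (lBi _).
have := shapeE (Ordinal (ltnW i1A)) (Ordinal jB) hT.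
case/tabkP: hT => _ h2 _ h4.
rewrite /indiag ltnn /= (leq_trans h (dl i)) /= => /esym/negbT; rewrite -leqNgt => hk.
have hc := h4 (Ordinal (ltnW i1A)) (Ordinal i1A) (Ordinal jB) (ltnSn i) h.
have := h2 (Ordinal i1A, Ordinal jB) h; rewrite ltnS => hk2.
by have := leq_ltn_trans hk hc; rewrite ltnNge hk2.
Qed.

Let shape_eq T m : tabk k.+1 l T -> hstrip l m ->
  (forall i j, indiag m (j : 'I_B) (i : 'I_A) = indiag l j i && (T (i, j) < k)) ->
  shape T = m.
Proof.
move=> hT /hstripP[sm hm] h; apply: (@eq_from_nth _ 0) => [|i _].
  by rewrite size_shape sm sl.
have ml : nth 0 m i <= nth 0 l i by case/andP: (hm i).
have [iA|iA] := ltnP i A; last first.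
  by rewrite nth_shape0 //; move: ml; rewrite lA // leqn0 => /eqP.
have E (j : 'I_B) : (j < nth 0 (shape T) i) = (j < nth 0 m i).
  by have := h (Ordinal iA) j; rewrite -shapeE.
have sB : nth 0 (shape T) i <= B := leq_trans (shape_le T i) (lBi i).
have mB : nth 0 m i <= B := leq_trans ml (lBi i).
apply/eqP; rewrite eqn_leq; apply/andP; split; rewrite leqNgt; apply/negP => hlt.
  by have := E (Ordinal (leq_trans hlt sB)); rewrite /= hlt ltnn.
by have := E (Ordinal (leq_trans hlt mB)); rewrite /= hlt ltnn.
Qed.

(** [ext] fills the strip [l/m] with the value [k] and [res] resets it to 0. They are inverse
    bijections between tableaux of shape [m] with entries below [k] and tableaux of shape [l] whose
    entries below [k] form [m]. *)
Let ext (m : seq nat) (T : filling) : filling :=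
  [ffun c : 'I_A * 'I_B => if indiag m c.2 c.1 then T c
             else if indiag l c.2 c.1 then inord k else ord0].
Let res (m : seq nat) (T : filling) : filling :=
  [ffun c : 'I_A * 'I_B => if indiag m c.2 c.1 then T c else ord0].

Let sub_indiag m i j : hstrip l m -> indiag m j i -> indiag l j i.
Proof. by case/hstripP => _ hm; move=> h; case/andP: (hm i) => _; apply: leq_trans. Qed.

Let inordk : (inord k : 'I_C.+1) = k :> nat. Proof. by rewrite inordK. Qed.

Let ext_tab m T : hstrip l m -> tabk k m T -> tabk k.+1 l (ext m T).
Proof.
move=> hm /tabkP[h1 h2 h3 h4]; have dm := hstrip_dec2 hm.
apply/tabkP; split.
- move=> c hc; rewrite ffunE (negbTE hc); case: ifP => // hm'.
  by rewrite (sub_indiag hm hm') in hc.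
- move=> c hc; rewrite ffunE hc; case: ifP => [/h2/ltnW //|_].
  by rewrite inordk.
- move=> i j j' jj' hj'; rewrite !ffunE /= hj'.
  have hlj : indiag l j i := ltn_trans jj' hj'.
  rewrite hlj; case: ifP => [hmj|hmj]; case: ifP => [hmj'|hmj'].
  + exact: h3.
  + by rewrite inordk ltnW //; apply: (h2 (i, j)).
  + by rewrite (ltn_trans jj' hmj' : indiag m j i) in hmj.
  + by [].
- move=> i i' j ii' hj'; rewrite !ffunE /= hj'.
  (* In a horizontal strip, the cells above a cell of [l] lie in [m], so two values [k] never share
     a column. *)
  have hmj : indiag m j i.
    case/hstripP: hm => _ /(_ i)/andP[hi _]; apply: leq_trans hi.
    exact: leq_trans hj' (dec_le dl ii').
  rewrite hmj; case: ifP => [hmj'|hmj']; first exact: h4.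
  by rewrite inordk; apply: (h2 (i, j)).
Qed.

Let res_tab m T : hstrip l m -> tabk k.+1 l T -> shape T = m -> tabk k m (res m T).
Proof.
move=> hm hT e; have dm := hstrip_dec2 hm.
have E i j := shapeE i j hT; rewrite e in E.
case/tabkP: hT => h1 h2 h3 h4; apply/tabkP; split.
- by move=> c /negbTE hc; rewrite ffunE hc.
- by move=> [i j] /= hc; rewrite ffunE /= hc; move: hc; rewrite E => /andP[].
- move=> i j j' jj' hj'; rewrite !ffunE /= hj' (ltn_trans jj' hj' : indiag m j i).
  by apply: h3 => //; apply: sub_indiag hj'.
- move=> i i' j ii' hj'; rewrite !ffunE /= hj'.
  rewrite (leq_trans hj' (dec_le dm (ltnW ii')) : indiag m j i).
  by apply: h4 => //; apply: sub_indiag hj'.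
Qed.

Lemma tab_branch : (tab k.+1 l = \sum_(m <- box L (nth 0%N l 0) | hstrip l m)
   x k ^+ (sumn l - sumn m) * tab k m)%R.
Proof.
rewrite /tab.
transitivity (\sum_(T : filling | tabk k.+1 l T)
   \sum_(m <- box L (nth 0%N l 0) | hstrip l m && (shape T == m))
    \prod_(c : cell | indiag l c.2 c.1) x (T c))%R.
  apply: eq_bigr => T hT; rewrite -[RHS]big_filter.
  rewrite (eq_in_filter (a2 := pred1 (shape T))) => [|m _ /=].
    rewrite filter_pred1_uniq ?uniq_box ?big_seq1 //.
    apply/box_nthP; split => // i.
    exact: leq_trans (shape_le T i) (dec_le dl (leq0n i)).
  by rewrite eq_sym; case: eqP => [->|]; rewrite ?shape_hstrip ?andbF.
rewrite (exchange_big_dep (hstrip l)) /= => [|T m _ /andP[] //].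
apply: eq_bigr => m hm; rewrite (reindex_onto (ext m) (res m)) /=; last first.
  move=> T /andP[hT /andP[_ /eqP e]]; have E i j := shapeE i j hT; rewrite e in E.
  apply/ffunP => -[i j]; rewrite !ffunE /=; case: (boolP (indiag m j i)) => //= hmj.
  case: (boolP (indiag l j i)) => hlj.
    apply/ord_inj; rewrite inordk; move: hmj; rewrite E hlj /=.
    case/tabkP: hT => _ /(_ (i, j) hlj); rewrite ltnS => h _ _.
    by rewrite -leqNgt => h'; apply/eqP; rewrite eqn_leq h h'.
  by case/tabkP: hT => /(_ (i, j)) /= ->; rewrite ?hlj.
rewrite hm /= mulr_sumr; apply: eq_big => [T|T].
  apply/andP/idP => [[/andP[h1 /eqP h2] /eqP h3]|hT].
    by rewrite -h3; apply: res_tab.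
  have he := ext_tab hm hT; rewrite he /=; split; apply/eqP.
    apply: shape_eq => // i j; rewrite ffunE /=.
    case: ifP => hmj.
      by rewrite (sub_indiag hm hmj); case/tabkP: hT => _ /(_ (i, j) hmj) ->.
    by case: ifP => //; rewrite inordk ltnn.
  apply/ffunP => c; rewrite !ffunE; case: (boolP (indiag m c.2 c.1)) => // hc.
  by case/tabkP: hT => /(_ c hc) ->.
move=> _; rewrite (bigID (fun c : cell => indiag m c.2 c.1)) /= mulrC.
congr (_ * _)%R; last first.
  apply: eq_big => [c|c /andP[_ hc]]; last by rewrite ffunE hc.
  by apply/andP/idP => [[]|hc] //; rewrite (sub_indiag hm hc).
rewrite (eq_bigr (fun=> x k)) => [|c /andP[hl /negbTE hc]]; last first.
  by rewrite ffunE hc hl inordk.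
rewrite prodr_const; congr (_ ^+ _)%R.
have ml i : nth 0 m i <= nth 0 l i by case/hstripP: hm => _ /(_ i)/andP[].
rewrite -(@sum_cells A B l) // -(@sum_cells A B m) => [|i|i]; first last.
- exact: leq_trans (ml i) (lBi i).
- by move=> Ai; move: (ml i); rewrite lA // leqn0 => /eqP.
rewrite [X in _ = (X - _)](bigID (fun c : cell => indiag m c.2 c.1)) /=.
rewrite (eq_bigl (fun c : cell => indiag m c.2 c.1)) => [|c].
  by rewrite addKn sum1_card.
by apply/andP/idP => [[]|hc] //; rewrite (sub_indiag hm hc).
Qed.

End Branch.

Lemma tab_gs L k l : k <= C.+1 -> size l = L -> dec l ->
  (forall i, A <= i -> nth 0 l i = 0) -> nth 0 l 0 <= B -> tab k l = gs x k l.
Proof.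
elim: k l => [|k IH] l kC sl dl lA lB; last first.
  rewrite (@tab_branch L) // (@gsS _ x (nth 0 l 0)) // sl big_seq_cond [RHS]big_seq_cond.
  apply: eq_bigr => m /andP[/box_nthP[sm hm] hs]; rewrite IH // ?(ltnW kC) //.
  - exact: hstrip_dec2 hs.
  - move=> i Ai; case/hstripP: hs => _ /(_ i)/andP[_]; rewrite lA // leqn0.
    by move/eqP.
  - exact: leq_trans (hm 0) lB.
rewrite /tab /=; case: (posnP (nth 0 l 0)) => [l0|l0].
  have z i : nth 0 l i = 0 by move: (dec_le dl (leq0n i)); rewrite l0 leqn0 => /eqP.
  have -> : all (eq_op 0) l by apply/(all_nthP 0) => i _; rewrite z.
  rewrite (big_pred1 [ffun=> ord0]) => [|T].
    by rewrite big_pred0 // => c; rewrite /indiag z.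
  apply/tabkP/eqP => [[h _ _ _]|->].
    by apply/ffunP => c; rewrite ffunE h // /indiag z.
  by split=> [c _|c|i j j' _|i i' j _]; rewrite ?ffunE // /indiag z.
have -> : all (eq_op 0) l = false.
  by apply/negbTE/allPn; exists (nth 0 l 0); [apply/mem_nth; case: (l) l0|rewrite eq_sym -lt0n].
have A0 : 0 < A by rewrite ltnNge; apply: contraL l0 => /lA ->.
have B0 : 0 < B := leq_trans l0 lB.
rewrite big_pred0 // => T; apply/negbTE/tabkP => -[_ h _ _].
by have := h (Ordinal A0, Ordinal B0) l0.
Qed.

End Tableaux.

(** * Padding to a common length and the final argument *)

Definition pad (L : nat) (l : seq nat) : seq nat := mkseq (nth 0 l) L.

Lemma nth_pad L l i : size l <= L -> nth 0 (pad L l) i = nth 0 l i.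
Proof.
move=> sl; have [iL|iL] := ltnP i L; first by rewrite nth_mkseq.
by rewrite !nth_default ?size_mkseq // (leq_trans sl).
Qed.

Lemma is_part_dec l : is_part l -> dec l.
Proof.
case/andP => sl _ i; have [il|il] := ltnP i.+1 (size l); last by rewrite nth_default.
by have /(sortedP 0) := sl; apply.
Qed.

Lemma pad_isdec L l : size l <= L -> is_part l -> isdec L (pad L l).
Proof.
move=> sl pl; split; first by rewrite size_mkseq.
by move=> i; rewrite !nth_pad //; apply: is_part_dec.
Qed.

Lemma nth_part_gt0 l i : is_part l -> (0 < nth 0 l i) = (i < size l).
Proof.
case/andP => _ /(all_nthP 0) h; have [il|il] := ltnP i (size l); first exact: h.
by rewrite nth_default.
Qed.

Lemma pad_inj L l m : size l <= L -> size m <= L -> is_part l -> is_part m ->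
  pad L l = pad L m -> l = m.
Proof.
move=> sl sm pl pm e.
have en i : nth 0 l i = nth 0 m i by rewrite -(nth_pad i sl) e nth_pad.
have es i : (i < size l) = (i < size m) by rewrite -!nth_part_gt0 // en.
apply: (@eq_from_nth _ 0) => [|i _]; last exact: en.
by apply/eqP; rewrite eqn_leq; apply/andP; split; rewrite leqNgt ?es ?ltnn // -es ltnn.
Qed.

Lemma schur_gs N L l : size l <= L -> is_part l ->
  schur N.+1 l = gs (mvar N.+1) N.+1 (pad L l).
Proof.
move=> sl pl; have [spad dpad] := pad_isdec sl pl.
rewrite -(@tab_gs (size l) (nth 0 l 0) N _ _ L) //; first last.
- by rewrite nth_pad.
- by move=> i li; rewrite nth_pad // nth_default.
have E j i : indiag (pad L l) j i = indiag l j i by rewrite /indiag nth_pad.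
rewrite /schur /tab; apply: eq_big => [T|T _]; last first.
  apply: eq_big => [c|c _]; first by rewrite E.
  by rewrite /mvar insubT // => h; congr (mpolyX _ U_(_)); apply: val_inj.
have H : [forall c : 'I_(size l) * 'I_(nth 0 l 0),
    indiag (pad L l) c.2 c.1 ==> (T c < N.+1)].
  by apply/forallP => c; apply/implyP => _; apply: ltn_ord.
rewrite /ssytb /tabk H /=; congr [&& _, _ & _]; apply: eq_forallb => a; rewrite ?E //.
  by apply: eq_forallb => b; apply: eq_forallb => c; rewrite E.
by apply: eq_forallb => b; apply: eq_forallb => c; rewrite E.
Qed.

Theorem mainTheorem2 (n : nat) (hn : 0 < n) (mu : 'I_n -> seq nat)
    (hmu : forall k, is_part (mu k))
    (N : nat) (s : seq (seq nat)) (c : seq nat -> int)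
    (hs_uniq : uniq s) (hs_part : all is_part s)
    (hs_size : all (fun nu => size nu <= N) s)
    (hexp : (\prod_(k < n) schur N (mu k) =
             \sum_(nu <- s) c nu *: schur N nu)%R)
    (lam : seq nat) (hlam : lam \in s) (hc : c lam != 0%R) :
  forall p : 'I_n -> nat * nat, (forall k, isOC (mu k) (p k)) ->
  forall j i : nat, indiag lam j i ->
    ~~ ((\sum_(k < n) (p k).1 <= j) && (\sum_(k < n) (p k).2 <= i)).
Proof.
move=> p hp j i hji; apply/negP => /andP[hj hi].
have lamN := allP hs_size lam hlam; have plam := allP hs_part lam hlam.
(* Without variables [lam] is empty and has no cell; the tableau lemmas assume a nonempty
   alphabet. *)
case: N hs_size hexp lamN => [|N] hs_size hexp lamN.
  by move: lamN hji; rewrite leqn0 => /nilP ->; rewrite /indiag nth_nil.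
(* Long enough for Pieri's rule in [N.+1] variables and for every [mu k], whose number of rows is
   not bounded by [N.+1]. *)
pose L := N.+1 + \sum_(k < n) size (mu k).
have NL : N.+1 <= L by rewrite leq_addr.
have muL k : size (mu k) <= L.
  by rewrite /L (bigD1 k) //= addnCA leq_addr.
have Hprod : gspan (mvar N.+1) N.+1
    (hook L (\sum_(k < n) (p k).2) (\sum_(k < n) (p k).1)) (\prod_(k < n) schur N.+1 (mu k))%R.
  elim/big_rec3: _ => [|k f b a _ IH].
    rewrite -(gs_zero (mvar N.+1) L N.+1); apply: gspan_gen.
    by split=> [|m|]; rewrite ?size_nseq // !nth_nseq !if_same.
  apply: hook_mul => //; rewrite (schur_gs _ (muL k)) //; apply: gspan_gen.
  have [sk dk] := pad_isdec (muL k) (hmu k); split => //.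
  by rewrite nth_pad // leqNgt; case/and3P: (hp k).
(* As [lam] contains a cell above the sum of the corners in the componentwise order, it contains
   that sum, so it is not among the shapes spanning the product. *)
have nlam : (\sum_(k < n) (p k).1 < nth 0 lam (\sum_(k < n) (p k).2)).
  exact: leq_ltn_trans hj (leq_trans hji (dec_le (is_part_dec plam) hi)).
have lamL := leq_trans lamN NL.
have := @gs_indep N.+1 L (pad L lam) (c lam) (pad_isdec lamL plam).
rewrite nth_pad // nth_default // => /(_ erefl) indep.
move/eqP: hc; apply; apply: indep.
(* Both the product and the remaining terms lie in the span of shapes other than [lam], so
   independence forces [c lam = 0]. *)
have {hexp} -> : (gs (mvar N.+1) N.+1 (pad L lam) *~ c lam =
   \prod_(k < n) schur N.+1 (mu k) -
   \sum_(nu <- s | nu != lam) gs (mvar N.+1) N.+1 (pad L nu) *~ c nu)%R.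
  apply/eqP; rewrite eq_sym subr_eq hexp (bigD1_seq lam) //=; apply/eqP; congr (_ + _)%R.
    by rewrite (schur_gs _ lamL) // -scaler_int intz.
  rewrite big_seq_cond [RHS]big_seq_cond; apply: eq_bigr => nu /andP[nus _].
  have nuN := allP hs_size nu nus; have pnu := allP hs_part nu nus.
  by rewrite (schur_gs _ (leq_trans nuN NL)) // -scaler_int intz.
apply: gspanD.
  elim: Hprod => [|d l f [sl dl hl] _ IH]; first exact: gspan0.
  apply: gspanS => //; split => //; apply/eqP => e.
  by move: hl; rewrite e nth_pad // leqNgt nlam.
apply: gspanN; apply: gspan_sum => nu nus nunl; apply: gspanZ; apply: gspan_gen.
have nuL := leq_trans (allP hs_size nu nus) NL; have pnu := allP hs_part nu nus.
split; first exact: pad_isdec.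
by apply: contra nunl => /eqP/pad_inj -> //.
Qed.
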